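(* Let $n \ge 1$ and consider $\mathbb{Z}^n$ with the rectangular partial order ($\mathbf{x} \le \mathbf{y}$ iff $x_i \le y_i$ for all $i$). Let $\mathcal{J}$ be the set of all downward closed nonempty finite subsets of $\mathbb{N}_0^n\setminus\{\mathbf{0}\}$, and for $A \subseteq \mathbb{Z}^n$ let $\sigma_{\mathcal{J}}(A) = \inf\{ |A\cap J|/|J| : J \in \mathcal{J}\}$. If $A$ is a subset of $\mathbb{N}_0^n\setminus\{\mathbf{0}\}$ with $\sigma_{\mathcal{J}}(A) > 0$, then $A$ is a basis for $\mathbb{N}_0^n \setminus\{\mathbf{0}\}$: there exists a positive integer $h$ such that $\mathbb{N}_0^n\setminus\{\mathbf{0}\} \subseteq hA$, where $hA = \{\mathbf{a}_1+\cdots+\mathbf{a}_h : \mathbf{a}_i \in A \cup\{\mathbf{0}\} \text{ for all } i\}$.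
   Context: $\mathbb{N}_0 = \{0,1,2,\dots\}$. We write $\mathbf{x}<\mathbf{y}$ if $\mathbf{x}\le\mathbf{y}$ and $\mathbf{x}\ne\mathbf{y}$. A subset $J \subseteq \mathbb{N}_0^n\setminus\{\mathbf{0}\}$ is downward closed if $\mathbf{x} \in J$ implies $\{\mathbf{y} \in \mathbb{Z}^n : \mathbf{0} < \mathbf{y} < \mathbf{x}\} \subseteq J$. *)

(* Defs.v *)
From HB Require Import structures.
From mathcomp Require Import all_boot all_order all_algebra finmap.
From mathcomp Require Import all_classical reals.
Set Implicit Arguments.
Unset Strict Implicit.
Unset Printing Implicit Defensive.
Import Order.TTheory GRing.Theory Num.Theory.

Local Open Scope classical_set_scope.
Local Open Scope ring_scope.

Definition vle (n : nat) (x y : 'rV[int]_n) : Prop :=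
  forall i : 'I_n, x 0 i <= y 0 i.

Definition vlt (n : nat) (x y : 'rV[int]_n) : Prop := vle x y /\ x <> y.

Definition nneg_nonzero (n : nat) : set 'rV[int]_n :=
  [set x | (forall i : 'I_n, 0 <= x 0 i) /\ x <> 0].

Definition downward_closed (n : nat) (J : set 'rV[int]_n) : Prop :=
  forall x, J x -> [set y | vlt 0 y /\ vlt y x] `<=` J.

Definition dc_family (n : nat) : set {fset 'rV[int]_n} :=
  [set J | [/\ [set` J] `<=` @nneg_nonzero n, [set` J] !=set0
             & downward_closed [set` J]]].

Definition rel_card (R : realType) (n : nat) (A : set 'rV[int]_n)
    (J : {fset 'rV[int]_n}) : R :=
  #|` [fset x in J | x \in A]%fset |%:R / #|` J|%:R.

(* For 0 < n the set of ratios is nonempty and bounded below by 0, so that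
   [inf] is a genuine infimum and not its default value. *)
Definition sigma (R : realType) (n : nat) (A : set 'rV[int]_n) : R :=
  inf [set rel_card R A J | J in @dc_family n].

Definition hfold_sumset (n : nat) (h : nat) (A : set 'rV[int]_n) :
    set 'rV[int]_n :=
  [set x | exists a : 'I_h -> 'rV[int]_n,
     (forall i, (A `|` [set 0]) (a i)) /\ x = \sum_(i < h) a i].

Definition is_basis (n : nat) (A B : set 'rV[int]_n) : Prop :=
  exists h : nat, (0 < h)%N /\ B `<=` hfold_sumset h A.

(* Main.v *)
(** Schnirelmann's argument. If [X] and [Y] contain [0] and have densities at
    least [r] and [s], then [X + Y] has density at least [1 - (1 - r)(1 - s)]:
    given a downward closed [J], send each [x] in [J] outside [X] to an element
    [a <= x] of [X] that is maximal for a fixed linear extension of the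
    partial order. The points sent to [a] form a translate by [a] of a downward
    closed set, so at least a proportion [s] of them lie in [a + Y]. Hence some
    [hA] has density at least [1/2], and a pigeonhole on the box below [x]
    then writes [x] as a sum of two elements of [hA]. *)
Require Import Defs.
From mathcomp Require Import all_boot all_order all_algebra finmap.
From mathcomp Require Import all_classical reals.
From mathcomp Require Import zify lra.
Set Implicit Arguments.
Unset Strict Implicit.
Import Order.TTheory GRing.Theory Num.Theory.
Local Open Scope classical_set_scope.
Local Open Scope ring_scope.

(** * Counting by fibers and an exponential estimate *)

Lemma card_fiberwise_le (R : realType) (T : choiceType) (I : finType)
    (B P : {fset T}) (k : T -> I) (r : R) :
  (forall i, r * #|` [fset x in B | k x == i]%fset|%:R
             <= #|` [fset x in P | k x == i]%fset|%:R) ->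
  r * #|` B|%:R <= #|` P|%:R.
Proof.
have card_fibers (C : {fset T}) :
    #|` C| = (\sum_i #|` [fset x in C | k x == i]%fset|)%N.
  rewrite card_fset_sum1 (partition_big k xpredT) //=.
  by apply: eq_bigr => i _; rewrite card_fset_sum1 big_fset.
move=> le_fibers; rewrite !card_fibers !natr_sum mulr_sumr.
exact: ler_sum.
Qed.

(** Induction works because [(1 - r) * (1 + (t + 1) * r) = 1 + t * r - (t + 1) * r ^ 2]; once
    [h * r >= 1], the factor [1 + h * r] is at least 2. *)
Lemma exists_expr_le_half (R : realType) (r : R) : 0 < r -> r <= 1 ->
  exists h, (1 - r) ^+ h.+1 <= 1 / 2.
Proof.
move=> r0 r1.
have bernoulli h : (1 - r) ^+ h * (1 + h%:R * r) <= 1.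
  elim: h => [|h]; first by rewrite expr0 mul0r addr0 mulr1.
  apply: le_trans; rewrite exprSr -mulrA ler_wpM2l ?exprn_ge0 ?subr_ge0 //.
  rewrite -natr1; have : 0 <= h%:R :> R by exact: ler0n.
  move: (h%:R : R) => t t0.
  have : 0 <= (t + 1) * (r * r) by rewrite !mulr_ge0 ?addr_ge0 // ltW.
  nra.
exists (Num.truncn r^-1); set h := _.+1.
have hr : 1 <= h%:R * r.
  by rewrite -ler_pdivrMr // mul1r ltW // truncnS_gt.
have := bernoulli h.
have : 0 <= (1 - r) ^+ h by rewrite exprn_ge0 // subr_ge0.
move: ((1 - r) ^+ h) => q q0 hq; nra.
Qed.

(** * The componentwise order, finite boxes and the coordinate sum *)

Lemma vle_refl (n : nat) (x : 'rV[int]_n) : vle x x.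
Proof. by move=> i. Qed.

Lemma vle_trans (n : nat) (x y z : 'rV[int]_n) : vle x y -> vle y z -> vle x z.
Proof. by move=> xy yz i; exact: le_trans (xy i) (yz i). Qed.

Lemma vle_subr (n : nat) (a x y : 'rV[int]_n) : vle y (x - a) <-> vle (a + y) x.
Proof. by split=> + i => /(_ i); rewrite !mxE; lra. Qed.

Lemma vle_addr (n : nat) (x y : 'rV[int]_n) : vle 0 y -> vle x (x + y).
Proof. by move=> + i => /(_ i); rewrite !mxE; lra. Qed.

Lemma vle_subl (n : nat) (x y : 'rV[int]_n) : vle 0 y -> vle (x - y) x.
Proof. by move=> + i => /(_ i); rewrite !mxE; lra. Qed.

Lemma vle0_addr_eq0 (n : nat) (x y : 'rV[int]_n) :
  vle 0 x -> vle 0 y -> x + y = 0 -> y = 0.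
Proof.
move=> x0 y0 /rowP xy; apply/rowP => i.
by have := x0 i; have := y0 i; have := xy i; rewrite !mxE; lra.
Qed.

(* In [nneg_nonzero] the condition [x <> 0] compares [x] with the zero function,
   through the coercion of matrices to functions. *)
Lemma nneg_nonzeroE (n : nat) (x : 'rV[int]_n) :
  nneg_nonzero x <-> vle 0 x /\ x <> 0.
Proof.
split=> -[x0 xN0]; split=> [i|x_eq0].
- by have := x0 i; rewrite mxE.
- by apply: xN0; apply/funext => i; apply/funext => j; rewrite x_eq0 mxE.
- by have := x0 i; rewrite mxE.
- by apply: xN0; apply/matrixP => i j; rewrite x_eq0 mxE.
Qed.

Lemma finite_box (n : nat) (x : 'rV[int]_n) :
  finite_set [set y | vle 0 y /\ vle y x].
Proof.
(* One bound for all coordinates at once, so that finitely many functions into ['I_m.+1] cover the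
   box. *)
pose m := (\sum_i `|x 0%R i|)%N.
pose F (f : {ffun 'I_n -> 'I_m.+1}) : 'rV[int]_n := \row_i (f i : nat)%:Z.
apply: (@sub_finite_set _ _ (range F)); last exact: finite_image.
move=> y /= [y0 yx]; exists [ffun i => inord `|y 0%R i|%N] => //.
have {}y0 i : 0 <= y 0 i by have := y0 i; rewrite mxE.
apply/rowP => i; rewrite mxE ffunE inordK; first by rewrite gez0_abs.
rewrite ltnS /m (bigD1 i) //=; apply: leq_trans (leq_addr _ _).
by have := y0 i; have := yx i; move: (x 0 i) (y 0 i) => u v; lia.
Qed.

Definition coord_sum (n : nat) (x : 'rV[int]_n) : int := \sum_i x 0 i.

Lemma coord_sum_addr (n : nat) (x y : 'rV[int]_n) :
  vle 0 y -> y <> 0 -> coord_sum x < coord_sum (x + y).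
Proof.
move=> y0 yN0; rewrite /coord_sum.
under [ltRHS]eq_bigr do rewrite mxE.
rewrite big_split /= ltrDl lt_neqAle eq_sym.
have y0' i : true -> 0 <= y 0 i by move=> _; have := y0 i; rewrite mxE.
rewrite sumr_ge0 // andbT psumr_eq0 //; apply/negP => /allP y_eq0.
apply: yN0; apply/rowP => i; rewrite mxE; apply/eqP.
by apply: y_eq0; rewrite mem_index_enum.
Qed.

(** * Lower bounds for densities *)

Definition density_ge (R : realType) (n : nat) (r : R) (A : set 'rV[int]_n) :=
  forall J, dc_family J -> r * #|` J|%:R <= #|` [fset x in J | x \in A]%fset|%:R.

(** The only contact with [inf]: the ratios are bounded below by [0], so the infimum bounds each of
    them. From here on only the denominator-free [density_ge] is used. *)
Lemma density_ge_sigma (R : realType) (n : nat) (A : set 'rV[int]_n) :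
  density_ge (sigma R A) A.
Proof.
move=> J JF; have [_ [x Jx] _] := JF.
have J_gt0 : 0 < #|` J|%:R :> R.
  by rewrite ltr0n cardfs_gt0; apply/fset0Pn; exists x.
rewrite -ler_pdivlMr //; apply: ge_inf; last by exists J.
by exists 0 => _ [K _ <-]; rewrite divr_ge0.
Qed.

Lemma density_ge_le (R : realType) (n : nat) (r s : R) (A B : set 'rV[int]_n) :
  s <= r -> A `<=` B -> density_ge r A -> density_ge s B.
Proof.
move=> sr AB dA J JF; apply: le_trans (ler_wpM2r _ sr) _; first exact: ler0n.
apply: le_trans (dA J JF) _; rewrite ler_nat; apply: fsubset_leq_card.
apply/fsubsetP => x; rewrite !inE /= => /andP[-> /set_mem Ax] /=.
by apply/mem_set/AB.
Qed.

Definition sumset (n : nat) (X Y : set 'rV[int]_n) : set 'rV[int]_n :=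
  [set x | exists a b, [/\ X a, Y b & x = a + b]].

Section Schnirelmann.
Variables (R : realType) (n : nat) (X Y : set 'rV[int]_n).
Hypotheses (X0 : X 0) (Y0 : Y 0).

(** * Fibers over the maximal points of [X] *)

Section Fibers.
Variable J : {fset 'rV[int]_n}.
Hypothesis JF : dc_family J.

(* The decreasing order by coordinate sum is the linear extension: the first
   point of the list below [x] is maximal among those below [x]. *)
Definition base_points : seq 'rV[int]_n :=
  sort (fun a b => coord_sum b <= coord_sum a)
    (0 :: [fset x in J | x \in X]%fset).

Definition base_index (x : 'rV[int]_n) : nat :=
  find (fun a => `[< vle a x >]) base_points.

Definition outside : {fset 'rV[int]_n} := [fset x in J | x \notin X]%fset.

Definition base_fiber (i : nat) : {fset 'rV[int]_n} :=
  [fset x in outside | base_index x == i]%fset.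

Lemma mem_base_points a :
  (a \in base_points) = (a == 0) || (a \in J) && (a \in X).
Proof. by rewrite mem_sort !inE. Qed.

Lemma J_nneg x : x \in J -> vle 0 x /\ x <> 0.
Proof. by case: JF => JS _ _ /JS /nneg_nonzeroE. Qed.

(** [find] returns the length of the list when it fails; the listed point [0], below every point of
    [J], rules this out. *)
Lemma base_index_lt x : x \in J -> (base_index x < size base_points)%N.
Proof.
move=> /J_nneg[x0 _]; rewrite -has_find; apply/hasP; exists 0.
  by rewrite mem_base_points eqxx.
exact/asboolP.
Qed.

Lemma base_point_le x : x \in J -> vle base_points`_(base_index x) x.
Proof.
move=> /base_index_lt; rewrite -has_find => h; apply/asboolP.
exact: (nth_find 0 h).
Qed.

Lemma base_point_mem x : x \in J -> X base_points`_(base_index x).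
Proof.
move=> /base_index_lt /(mem_nth 0); rewrite mem_base_points.
by case/orP => [/eqP -> // | /andP[_ /set_mem]].
Qed.

(** The fiber translated by minus its base point is downward closed: [a + y] stays below [x], so
    anything forcing it out of the fiber would contradict the choice of [a] for [x]. *)
Lemma base_fiber_translate_down i x y :
  x \in base_fiber i -> vlt 0 y -> vle y (x - base_points`_i) ->
  base_points`_i + y \in base_fiber i.
Proof.
rewrite !inE /= => /andP[/andP[xJ xX] /eqP xi] [y0 /nesym yN0].
set a := base_points`_i => /vle_subr ayx.
have i_lt : (i < size base_points)%N by rewrite -xi base_index_lt.
have ax : vle a x by rewrite /a -xi; exact: base_point_le.
have not_before j : (j < i)%N -> ~ vle base_points`_j x.
  by rewrite -{1}xi => /(before_find 0) /asboolPn.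
have [_ _ Jdown] := JF.
have a_ge0 : vle 0 a.
  have := mem_nth 0 i_lt; rewrite -/a mem_base_points.
  by case/orP => [/eqP -> // | /andP[/J_nneg[]]].
have ay0 : vlt 0 (a + y).
  split; first exact: vle_trans a_ge0 (vle_addr _ y0).
  by move=> /esym/(vle0_addr_eq0 a_ge0 y0) /yN0.
have ayJ : a + y \in J.
  (* Downward closure only yields points strictly below [x]. *)
  have [-> //|ayNx] := eqVneq (a + y) x.
  by apply: (Jdown x) => //; split=> //; split=> //; exact/eqP.
have ayX : a + y \notin X.
  (* If [a + y] were in [X], its larger coordinate sum would list it before [a], yet it lies below
     [x]. *)
  apply/negP => ayX.
  have ay_mem : a + y \in base_points by rewrite mem_base_points ayJ ayX orbT.
  have j_lt := ay_mem; rewrite -index_mem in j_lt.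
  have [ji|ij] := ltnP (index (a + y) base_points) i.
    by apply: (not_before _ ji); rewrite nth_index.
  have s_sorted : sorted (fun a b => coord_sum b <= coord_sum a) base_points.
    by apply: sort_sorted => u v; exact: le_total.
  have := sorted_leq_nth (fun v u w uv vw => le_trans vw uv)
    (fun u => lexx _) 0 s_sorted _ _ i_lt j_lt ij.
  rewrite nth_index // -/a leNgt => /negP; apply.
  exact: coord_sum_addr.
(* The search for [a + y] stops at [a] at the latest; an earlier stop would be a point below [x]
   listed before [a]. *)
rewrite ayJ ayX /= eqn_leq; apply/andP; split.
  rewrite leqNgt; apply/negP => /(before_find 0) /asboolPn; apply.
  exact: vle_addr.
rewrite leqNgt; apply/negP => lt_i; apply: (not_before _ lt_i).
exact: vle_trans (base_point_le ayJ) ayx.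
Qed.

Lemma base_fiber_density (s : R) i : density_ge s Y ->
  s * #|` base_fiber i|%:R
    <= #|` [fset x in base_fiber i | x \in sumset X Y]%fset|%:R.
Proof.
(* Members of [dc_family] are nonempty, so the empty fiber is treated apart. *)
move=> dY; have [->|/fset0Pn[x0 x0i]] := eqVneq (base_fiber i) fset0.
  by rewrite cardfs0 mulr0 ler0n.
set a := base_points`_i.
pose L := [fset x - a | x in base_fiber i]%fset.
have fiberP x : x \in base_fiber i -> [/\ x \in J, vle a x & X a] /\ ~ X x.
  rewrite !inE /= => /andP[/andP[xJ xX] /eqP xi].
  split; last by move/mem_set; apply/negP.
  by rewrite /a -xi; split; [|exact: base_point_le|exact: base_point_mem].
(* [L] misses [0] because [a] is in [X] and the fiber avoids [X]. *)
have LF : dc_family L.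
  split.
  - move=> _ /imfsetP[x /= /fiberP[[_ ax Xa] NXx] ->]; apply/nneg_nonzeroE.
    split; first by apply/vle_subr; rewrite addr0.
    by move/eqP; rewrite subr_eq0 => /eqP xa; rewrite xa in NXx.
  - by exists (x0 - a); exact: in_imfset.
  - move=> _ /imfsetP[x /= xi ->] y [y0 [yx _]].
    apply/imfsetP; exists (a + y); last by rewrite addrC addKr.
    exact: base_fiber_translate_down yx.
have card_L : #|` L| = #|` base_fiber i|.
  by rewrite card_imfset //; exact: addIr.
rewrite -card_L; apply: le_trans (dY L LF) _; rewrite ler_nat.
set LY := [fset y in L | y \in Y]%fset.
have <- : #|` [fset (a + y)%R | y in LY]%fset| = #|` LY|.
  by rewrite card_imfset //; exact: addrI.
apply: fsubset_leq_card.
apply/fsubsetP => _ /imfsetP[y /= + ->]; rewrite !inE /=.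
move=> /andP[/imfsetP[x /= xi ->] /set_mem Yxa].
have [[_ _ Xa] _] := fiberP _ xi.
have -> : a + (x - a) = x by rewrite addrC subrK.
move: (xi); rewrite !inE /= => -> /=; apply/mem_set.
by exists a, (x - a); split=> //; rewrite addrC subrK.
Qed.

End Fibers.

(** [X + Y] contains [X] and a proportion [s] of the rest of [J], hence at least
    [(1 - s) * #|J ∩ X| + s * #|J|] points; as [s <= 1], the density of [X] may be inserted. *)
Lemma density_ge_sumset (r s : R) : s <= 1 ->
  density_ge r X -> density_ge s Y ->
  density_ge (1 - (1 - r) * (1 - s)) (sumset X Y).
Proof.
move=> s1 dX dY J JF.
set JX := [fset x in J | x \in X]%fset.
set P := [fset x in outside J | x \in sumset X Y]%fset.
have dP : s * #|` outside J|%:R <= #|` P|%:R.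
  (* [inord] only serves to land in a finite type: on [J] the index is in range. *)
  pose k x : 'I_(size (base_points J)).+1 := inord (base_index J x).
  apply: (@card_fiberwise_le _ _ _ _ _ k) => i.
  have kE x : x \in J -> (k x == i) = (base_index J x == i).
    move=> /(base_index_lt JF) /ltnW x_lt.
    by rewrite -val_eqE /= inordK.
  have -> : [fset x in outside J | k x == i]%fset = base_fiber J i.
    apply/fsetP => x; rewrite !inE /=.
    by case xJ: (x \in J) => //=; rewrite kE.
  have -> : [fset x in P | k x == i]%fset =
      [fset x in base_fiber J i | x \in sumset X Y]%fset.
    apply/fsetP => x; rewrite !inE /=.
    by case xJ: (x \in J) => //=; rewrite kE // andbAC.
  exact: base_fiber_density.
have card_J : #|` J|%:R = #|` JX|%:R + #|` outside J|%:R :> R.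
  rewrite -natrD -cardfsUI; congr (_%:R).
  have -> : (JX `&` outside J = fset0)%fset.
    by apply/fsetP => x; rewrite !inE /=; case: (x \in X); rewrite ?andbF.
  rewrite cardfs0 addn0; congr #|` _|; apply/fsetP => x; rewrite !inE /=.
  by case: (x \in X); rewrite ?andbT ?andbF ?orbF.
have card_sum : #|` JX|%:R + #|` P|%:R
    <= #|` [fset x in J | x \in sumset X Y]%fset|%:R :> R.
  rewrite -natrD -cardfsUI ler_nat.
  have -> : (JX `&` P = fset0)%fset.
    by apply/fsetP => x; rewrite !inE /=; case: (x \in X); rewrite ?andbF.
  rewrite cardfs0 addn0; apply: fsubset_leq_card; apply/fsubsetP => x.
  rewrite !inE /= => /orP[/andP[-> /set_mem Xx]|/andP[/andP[-> _] ->] //].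
  by apply/mem_set; exists x, 0; rewrite addr0.
have := dX J JF; rewrite -/JX; move: card_J card_sum dP.
move: (#|` J|%:R : R) (#|` JX|%:R : R) (#|` outside J|%:R : R) => j p q.
move: (#|` P|%:R : R) => p' -> card_sum dP dJ; apply: le_trans card_sum.
nra.
Qed.

(** Pigeonhole: if [x] is not in [X + Y], then [J ∩ X] and [x - (J ∩ Y)] are disjoint. As [0] is in
    [X] and in [Y], both lie in [J] without [x], which has too few points for [r + s >= 1]. *)
Lemma sumset_total (r s : R) : 1 <= r + s ->
  density_ge r X -> density_ge s Y -> nneg_nonzero (n:=n) `<=` sumset X Y.
Proof.
move=> rs dX dY x /nneg_nonzeroE[x0 xN0]; apply: contrapT => Nx.
pose J := fset_set [set y | vle 0 y /\ vle y x /\ y <> 0].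
have JE y : y \in J <-> vle 0 y /\ vle y x /\ y <> 0.
  rewrite in_fset_set ?inE //; apply: sub_finite_set (finite_box x).
  by move=> z /= [? []].
have xJ : x \in J by apply/JE; split=> //; split=> //; exact: vle_refl.
have JF : dc_family J.
  split.
  - by move=> y /JE [? [? ?]]; apply/nneg_nonzeroE.
  - by exists x.
  - move=> y /JE [_ [yx _]] z [[z0 /nesym zN0] [zy _]]; apply/JE.
    by split=> //; split=> //; exact: vle_trans yx.
set JX := [fset y in J | y \in X]%fset.
set JY := [fset y in J | y \in Y]%fset.
pose Q := [fset x - y | y in JY]%fset.
have card_Q : #|` Q| = #|` JY|.
  by rewrite card_imfset //= => u v /addrI /oppr_inj.
have card_le : (#|` JX| + #|` Q| <= #|` (J `\ x)%fset|)%N.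
  rewrite -cardfsUI.
  have -> : (JX `&` Q = fset0)%fset.
    apply/fsetP => y; rewrite in_fset0; apply/negP; rewrite !inE /=.
    move=> /andP[/andP[_ /set_mem Xy]].
    move=> /imfsetP[z /=]; rewrite !inE /= => /andP[_ /set_mem Yz] yE.
    by apply: Nx; exists y, z; split=> //; rewrite yE subrK.
  rewrite cardfs0 addn0; apply: fsubset_leq_card; apply/fsubsetP => y.
  rewrite !inE /= => /orP[/andP[-> /set_mem Xy]|].
    rewrite andbT; apply/eqP => yx; apply: Nx; exists y, 0.
    by rewrite addr0.
  move=> /imfsetP[z /=]; rewrite !inE /= => /andP[/JE[z0 [zx zN0]] /set_mem Yz] ->.
  apply/andP; split.
    by apply/eqP => /eqP; rewrite subr_eq addrC -subr_eq subrr eq_sym => /eqP.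
  apply/JE; split; first by apply/vle_subr; rewrite addr0.
  split; first exact: vle_subl.
  move=> /eqP; rewrite subr_eq0 => /eqP xz; apply: Nx; exists 0, z.
  by rewrite add0r.
have card_J : #|` J| = (#|` (J `\ x)%fset|).+1 by rewrite (cardfsD1 x) xJ.
have := dX J JF; have := dY J JF; rewrite -/JX -/JY -card_Q card_J.
move: card_le; rewrite -(ler_nat R) natrD -natr1.
have : 0 <= #|` (J `\ x)%fset|%:R :> R by exact: ler0n.
move: (#|` (J `\ x)%fset|%:R : R) (#|` JX|%:R : R) (#|` Q|%:R : R) => j p q.
nra.
Qed.

End Schnirelmann.

(** * Iterated sumsets and the conclusion *)

Section Hfold.
Variables (n : nat) (A : set 'rV[int]_n).

Lemma hfold0 h : hfold_sumset h A 0.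
Proof. by exists (fun=> 0); split=> [i|]; [right|rewrite big1]. Qed.

Lemma hfold_le1 : A `<=` hfold_sumset 1 A.
Proof.
by move=> x Ax; exists (fun=> x); split=> [i|]; [left|rewrite big_ord1].
Qed.

Lemma hfoldD h k :
  sumset (hfold_sumset h A) (hfold_sumset k A) `<=` hfold_sumset (h + k) A.
Proof.
move=> _ [_ [_ [[a [aA ->]] [b [bA ->]] ->]]].
exists (fun i => match fintype.split i with inl j => a j | inr j => b j end).
split=> [i|]; first by case: (fintype.split i).
rewrite big_split_ord /=; congr (_ + _); apply: eq_bigr => i _.
  by rewrite (unsplitK (inl _ i)).
by rewrite (unsplitK (inr _ i)).
Qed.

(** Each further copy of [A] multiplies the defect from density 1 by [1 - r]. *)
Lemma density_ge_hfold (R : realType) (r : R) h : r <= 1 ->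
  density_ge r A -> density_ge (1 - (1 - r) ^+ h) (hfold_sumset h A).
Proof.
move=> r1 dA; elim: h => [|h IH].
  by move=> J _; rewrite expr0 subrr mul0r ler0n.
rewrite -addn1; apply: (density_ge_le (lexx _) (@hfoldD h 1)) _.
have := density_ge_sumset (hfold0 h) (hfold0 1) r1 IH
  (density_ge_le (lexx r) hfold_le1 dA).
by rewrite subKr addn1 exprSr.
Qed.

End Hfold.

Theorem theorem4p2 (R : realType) (n : nat) (hn : (0 < n)%N)
    (A : set 'rV[int]_n) (hA : A `<=` @nneg_nonzero n)
    (hsigma : 0 < sigma R A) :
  is_basis A (@nneg_nonzero n).
Proof.
(* The minimum supplies the bound [r <= 1] that the density lemmas ask for. *)
pose r : R := Num.min (sigma R A) 1.
have r0 : 0 < r by rewrite lt_min hsigma ltr01.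
have r1 : r <= 1 by rewrite ge_min lexx orbT.
have dA : density_ge r A.
  by apply: density_ge_le (@density_ge_sigma R n A) => //; rewrite ge_min lexx.
have [h hh] := exists_expr_le_half r0 r1.
(* Each block of [h.+1] summands has density at least 1/2, so two blocks meet the threshold of
   [sumset_total]. *)
exists (h.+1 + h.+1)%N; split=> //.
apply: subset_trans (@hfoldD _ _ _ _).
have dh := density_ge_hfold h.+1 r1 dA.
by apply: (sumset_total (hfold0 A _) (hfold0 A _) _ dh dh); lra.
Qed.
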